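(* Let $\mathcal C$ be an $N$-dimensional asymptotic class of finite $L$-structures, and let $\mathcal D$ be a class of finite $L'$-structures that is uniformly parameter-interpretable in $\mathcal C$ by an interpretation $\mathcal I$ of arity $r$. If $\mathcal I$ is quotient-trace reflecting, then $\mathcal D$ is an $L_Q$-dimensional asymptotic class, where $L_Q$ is the least common multiple of the positive exponents occurring in the ambient asymptotic sizes of the interpreted universe on target-unbounded cells. In particular, $L_Q\mid\operatorname{lcm}(1,2,\dots,Nr)$, and $\mathcal D$ is an $\operatorname{lcm}(1,2,\dots,Nr)$-dimensional asymptotic class.
   Context: Conventions. Languages $L,L'$ are countable first-order languages, possibly with finitely many sorts; function and constant symbols may be replaced by graph relations. All structures in the classes considered are finite, and $|M|$ is the total number of elements (summed over sorts). Uniform little-$o$. For a collection $\Phi$ (a ''cell'') of pairs $(M,\bar a)$, $f=o(g)$ uniformly on $\Phi$ means: for every $\varepsilon>0$ there is $Q$ with $|f(M,\bar a)|\le\varepsilon g(M,\bar a)$ for all $(M,\bar a)\in\Phi$ with $|M|>Q$. $N$-dimensional asymptotic class ($N\ge1$). A class $\mathcal C$ of finite $L$-structures such that for every $L$-formula $\varphi(x;\bar y)$ with a single object variable $x$ there are a finite set $D_\varphi\subseteq(\{0,\dots,N\}\times\mathbb R_{>0})\cup\{(0,0)\}$ and, for each $(d,\mu)\in D_\varphi$, a parameter-free $L$-formula $\theta_{d,\mu}(\bar y)$ such that in every $M\in\mathcal C$ the sets $\theta_{d,\mu}(M^{|\bar y|})$ partition $M^{|\bar y|}$, and, uniformly on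 the cell $\{(M,\bar a):M\models\theta_{d,\mu}(\bar a)\}$, $|\varphi(M;\bar a)|=\mu|M|^{d/N}+o(|M|^{d/N})$; for $(0,0)$ this means $|\varphi(M;\bar a)|=o(1)$. Uniform parameter-interpretation $\mathcal I$ of $\mathcal D$ in $\mathcal C$, of arity $r\ge1$: an injection $\alpha:\mathcal D\to\mathcal C$; an integer $s\ge0$; fixed $L$-formulas $\delta(\bar u;\bar z)$, $\epsilon(\bar u,\bar v;\bar z)$ with $|\bar u|=|\bar v|=r$, $|\bar z|=s$; for each relation symbol $R\in L'$ a fixed $L$-formula $R^{\mathcal I}$ on the appropriate number of $r$-tuples (and $\bar z$); and for each $A\in\mathcal D$ a tuple $\bar c_A\in\alpha(A)^s$ and an $L'$-isomorphism $\iota_A:A\to X_A/E_A$, where $X_A=\delta(\alpha(A)^r;\bar c_A)$ and $E_A$ is the equivalence relation on $X_A$ defined by $\epsilon(\bar u,\bar v;\bar c_A)$; the formulas $R^{\mathcal I}$ (evaluated at $\bar c_A$) are $E_A$-invariant on $X_A$ and induce the $L'$-structure on $X_A/E_A$. A representative of $a\in A$ is an element of the class $\iota_A(a)$. Quotient-trace reflecting: for every $m\ge0$ and every parameter-free $L$-formula $\rho(\bar v_1,\dots,\bar v_m;\bar z)$ (each $\bar v_i$ an $r$-tuple) such that, for every $A\in\mathcal D$, $\rho(\cdot;\bar c_A)$ is $E_A$-invariant in each $\bar v_i$ on $X_A^m$, there is a parameter-free $L'$-formula $\rho^{\downarrow}(y_1,\dots,y_m)$ such that for every $A\in\mathcal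 D$, all $a_1,\dots,a_m\in A$ and arbitrary representatives $\bar v_i\in X_A$ of $a_i$: $A\models\rho^{\downarrow}(a_1,\dots,a_m)\iff\alpha(A)\models\rho(\bar v_1,\dots,\bar v_m;\bar c_A)$. (The case $m=0$ is included.) The number $L_Q$. There is a finite family of parameter-free $L$-formulas $\chi_{e,\lambda}(\bar z)$, indexed by pairs $(e,\lambda)\in(\{0,\dots,Nr\}\times\mathbb R_{>0})\cup\{(0,0)\}$, such that for each $A\in\mathcal D$ exactly one $\chi_{e,\lambda}(\bar c_A)$ holds in $M=\alpha(A)$, and uniformly on each cell $|A|=|X_A/E_A|=\lambda|M|^{e/N}+o(|M|^{e/N})$ (as $|M|\to\infty$). Fix such a partition. Let $\mathscr E_Q$ be the set of positive $e$ for which, for some $\lambda>0$, the structures $A\in\mathcal D$ with $\alpha(A)\models\chi_{e,\lambda}(\bar c_A)$ have unbounded cardinality. Then $L_Q=\operatorname{lcm}(\mathscr E_Q)$, with $\operatorname{lcm}(\varnothing)=1$. *)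

(* Defs.v *)
From HB Require Import structures.
From mathcomp Require Import all_boot all_order all_algebra.
From mathcomp Require Import all_classical all_reals all_analysis.

Set Implicit Arguments.
Unset Strict Implicit.
Unset Printing Implicit Defensive.

Import Order.TTheory GRing.Theory Num.Theory.

Local Open Scope classical_set_scope.
Local Open Scope ring_scope.

(** * Finite many-sorted relational structures

    A many-sorted structure is presented by its total domain together with the
    function giving the sort of each element.  Sorts act as unary predicates,
    and variables range over the total domain; as there are finitely many sorts,
    this has the same definable sets as the syntax with sorted variables.
    The one-sorted case is [sort := unit].  Function and constant symbols are
    represented by their graphs. *)

Record language := Language {
  sort : finType;
  symbol : countType;
  profile : symbol -> seq sort
}.

Definition predicate (L : language) : Type := (sort L + symbol L)%type.

Definition arity (L : language) (P : predicate L) : nat :=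
  match P with inl _ => 1%N | inr sy => size (profile sy) end.

Record structure (L : language) := Structure {
  carrier :> finType;
  sort_of : carrier -> sort L;
  interp : forall sy : symbol L, (size (profile sy)).-tuple carrier -> bool;
  interp_sorted : forall (sy : symbol L) (t : (size (profile sy)).-tuple carrier),
    interp t -> map sort_of t = profile sy
}.

Definition structure_class (L : language) : Type := structure L -> Prop.

Definition holds (L : language) (M : structure L) (P : predicate L) :
    (arity P).-tuple M -> bool :=
  match P return (arity P).-tuple M -> bool with
  | inl q => fun t => sort_of (thead t) == q
  | inr sy => fun t => interp t
  end.

(** Parameter-free formulas with free variables in [V].  In [Ex], the bound
    variable is [None] and the free variables of the scope are the [Some x]. *)
Inductive formula (L : language) (V : Type) : Type :=
| Bot : formula L V
| Eq : V -> V -> formula L V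
| Atom : forall P : predicate L, (arity P).-tuple V -> formula L V
| Not : formula L V -> formula L V
| And : formula L V -> formula L V -> formula L V
| Ex : formula L (option V) -> formula L V.

Fixpoint sat (L : language) (M : structure L) (V : Type) (phi : formula L V) :
    (V -> M) -> bool :=
  match phi with
  | Bot => fun _ => false
  | Eq x y => fun e => e x == e y
  | Atom P t => fun e => holds (map_tuple e t)
  | Not psi => fun e => ~~ sat psi e
  | And psi1 psi2 => fun e => sat psi1 e && sat psi2 e
  | Ex psi => fun e => [exists x : M, sat psi (oapp e x)]
  end.

(** The set [phi(M; b)], the object variable being [None]. *)
Definition solutions (L : language) (M : structure L) (V : Type)
    (phi : formula L (option V)) (b : V -> M) : {set M} :=
  [set x | sat phi (oapp b x)]%SET.

(** * Asymptotic classes *)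

Definition uniform_littleo (R : realType) (I : Type) (size : I -> nat)
    (Phi : I -> Prop) (f g : I -> R) : Prop :=
  forall eps : R, 0 < eps -> exists Q : nat, forall i : I,
    Phi i -> (Q < size i)%N -> `|f i| <= eps * g i.

(** [(d, mu)] lies in [({0, ..., K} x R_{>0}) U {(0, 0)}]. *)
Definition admissible (R : realType) (K : nat) (p : nat * R) : Prop :=
  ((p.1 <= K)%N /\ 0 < p.2) \/ p = (0%N, 0).

(** The [cell p], for [p] in the finite set [D], partition [I], and on [cell p]
    one has [count = mu * size ^ (d / N) + o(size ^ (d / N))] where
    [p = (d, mu)].  For [p = (0, 0)] this says [count = o(1)]. *)
Definition cell_estimate (R : realType) (N K : nat) (I : Type)
    (size count : I -> nat) (D : seq (nat * R)) (cell : nat * R -> I -> Prop) : Prop :=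
  [/\ forall p, p \in D -> admissible K p,
      forall i : I, exists! p, p \in D /\ cell p i
    & forall p, p \in D ->
        let g := fun i => (size i)%:R `^ (p.1%:R / N%:R) in
        uniform_littleo size (cell p) (fun i => (count i)%:R - p.2 * g i) g].

Definition asymptotic_class (R : realType) (N : nat) (L : language)
    (C : structure_class L) : Prop :=
  (0 < N)%N /\
  forall (n : nat) (phi : formula L (option 'I_n)),
    exists (D : seq (nat * R)) (theta : nat * R -> formula L 'I_n),
      @cell_estimate R N N {M : {M | C M} & n.-tuple (sval M)}
        (fun Mb => #|sval (tag Mb)|)
        (fun Mb => #|solutions phi (tnth (tagged Mb))|)
        D
        (fun p Mb => sat (theta p) (tnth (tagged Mb))).

(** * Interpretations *)

(** Variables of a formula in [m] many [r]-tuples and an [s]-tuple. *)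
Definition tvars (m r s : nat) : Type := ('I_m * 'I_r + 'I_s)%type.

Definition tsat (L : language) (M : structure L) (m r s : nat)
    (phi : formula L (tvars m r s)) (v : m.-tuple (r.-tuple M)) (c : s.-tuple M) :
    bool :=
  sat phi (fun x => match x with
                    | inl (i, j) => tnth (tnth v i) j
                    | inr k => tnth c k
                    end).

(** [i_delta] and [i_epsilon] define [X_A] and [E_A]; [i_pred] interprets the
    sort predicates of [L'] as well as its relation symbols.
    [i_iota A] sends an element to an equivalence class, given as a set of
    [r]-tuples; that it is a bijection onto [X_A / E_A] is part of
    [is_interpretation]. *)
Record interpretation_data (L L' : language) (C : structure_class L)
    (D : structure_class L') (r : nat) := InterpretationData {
  i_alpha : {A | D A} -> {M | C M};
  i_npar : nat;
  i_delta : formula L (tvars 1 r i_npar);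
  i_epsilon : formula L (tvars 2 r i_npar);
  i_pred : forall P : predicate L', formula L (tvars (arity P) r i_npar);
  i_par : forall A : {A | D A}, i_npar.-tuple (sval (i_alpha A));
  i_iota : forall A : {A | D A}, sval A -> {set r.-tuple (sval (i_alpha A))}
}.

Section Interpretation.
Variables (L L' : language) (C : structure_class L) (D : structure_class L').
Variables (r : nat) (I : interpretation_data C D r).
Implicit Type A : {A | D A}.

Definition i_target A : structure L := sval (i_alpha I A).

Definition i_sat A (m : nat) (rho : formula L (tvars m r (i_npar I)))
    (v : m.-tuple (r.-tuple (i_target A))) : bool :=
  tsat rho v (i_par I A).

Definition i_X A : {set r.-tuple (i_target A)} :=
  [set u | i_sat (i_delta I) [tuple u]]%SET.

Definition i_E A : rel (r.-tuple (i_target A)) :=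
  fun u v => i_sat (i_epsilon I) [tuple u; v].

Definition i_invariant (m : nat) (rho : formula L (tvars m r (i_npar I))) : Prop :=
  forall A (v w : m.-tuple (r.-tuple (i_target A))),
    (forall i, [/\ tnth v i \in i_X A, tnth w i \in i_X A
                 & i_E (tnth v i) (tnth w i)]) ->
    i_sat rho v = i_sat rho w.

Definition i_represents A (m : nat) (v : m.-tuple (r.-tuple (i_target A)))
    (a : m.-tuple (sval A)) : bool :=
  [forall i, tnth v i \in i_iota I (tnth a i)].

(** The right-hand side of [i_iota_morph] is the relation induced by [i_pred I P]
    on the quotient, taken at the classes [i_iota I (tnth a i)]. *)
Record is_interpretation : Prop := IsInterpretation {
  i_alpha_inj : injective (i_alpha I);
  i_equiv : forall A, {in i_X A & &, equivalence_rel (@i_E A)};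
  i_pred_invariant : forall P : predicate L', i_invariant (i_pred I P);
  i_iota_inj : forall A, injective (@i_iota _ _ _ _ _ I A);
  i_iota_image : forall A,
    [set i_iota I a | a : sval A]%SET = equivalence_partition (@i_E A) (i_X A);
  i_iota_morph : forall A (P : predicate L') (a : (arity P).-tuple (sval A)),
    holds a = [exists v, i_represents v a && i_sat (i_pred I P) v]
}.

Definition quotient_trace_reflecting : Prop :=
  forall (m : nat) (rho : formula L (tvars m r (i_npar I))),
    i_invariant rho ->
    exists rho' : formula L' 'I_m,
      forall A (a : m.-tuple (sval A)) (v : m.-tuple (r.-tuple (i_target A))),
        i_represents v a -> sat rho' (tnth a) = i_sat rho v.

(** * The dimension of the interpreted class *)

Definition size_partition (R : realType) (N : nat) (F : seq (nat * R))
    (chi : nat * R -> formula L 'I_(i_npar I)) : Prop :=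
  cell_estimate N (N * r)%N
    (fun A => #|i_target A|) (fun A => #|sval A|) F
    (fun p A => sat (chi p) (tnth (i_par I A))).

Definition target_exponents (R : realType) (F : seq (nat * R))
    (chi : nat * R -> formula L 'I_(i_npar I)) : set nat :=
  [set e | (0 < e)%N /\ exists lambda : R,
     [/\ 0 < lambda, (e, lambda) \in F
       & forall B : nat, exists A,
           sat (chi (e, lambda)) (tnth (i_par I A)) /\ (B < #|sval A|)%N]].

(** Each element of [target_exponents F chi] is the first component of a pair in
    [F], so this is its least common multiple, and [1] if it is empty. *)
Definition L_Q (R : realType) (F : seq (nat * R))
    (chi : nat * R -> formula L 'I_(i_npar I)) : nat :=
  \big[lcmn/1%N]_(p <- F | p.1 \in target_exponents F chi) p.1.

End Interpretation.

Definition lcm_upto (n : nat) : nat := \big[lcmn/1%N]_(1 <= k < n.+1) k.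

(* Main.v *)
Require Import Defs.
From HB Require Import structures.
From mathcomp Require Import all_boot all_order all_algebra.
From mathcomp Require Import all_classical all_reals all_analysis.

Set Implicit Arguments.
Unset Strict Implicit.
Unset Printing Implicit Defensive.

(** The functions of the parameters that admit, on each cell of a definable
    partition, an estimate [mu * |M| ^ (d / N)] with [d] an integer are closed under
    sums, inverses and summation over a variable.  Hence they include the number of
    classes of a definable equivalence relation on a definable set of [r]-tuples,
    which is [\sum_u 1 / |class of u|]; no invariance of the cells is needed for
    this.  Applied to translated formulas this estimates [|A|] and [|phi(A; a)|] in
    terms of [|M|].  Reflection pulls the saturated cells back to the interpreted
    structures, and eliminating [|M|] between [|A| ~ lambda |M| ^ (e / N)] and
    [|phi(A; a)| ~ nu |M| ^ (f / N)] gives [nu lambda ^ (- f / e) |A| ^ (f / e)],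
    where [f <= e] as [|phi(A; a)| <= |A|].  On a cell where [e] is not one of the
    target exponents, [|A|] is bounded and any estimate holds. *)

(** * Formulas *)

Section Formulas.
Variable L : language.

Fixpoint rename (V W : Type) (f : V -> W) (phi : formula L V) : formula L W :=
  match phi with
  | Bot => @Bot L W
  | Eq x y => Eq L (f x) (f y)
  | Atom P t => Atom (map_tuple f t)
  | Not psi => Not (rename f psi)
  | And psi1 psi2 => And (rename f psi1) (rename f psi2)
  | Ex psi => Ex (rename (omap f) psi)
  end.

Lemma sat_Ex (M : structure L) (V : Type) (phi : formula L (option V)) (e : V -> M) :
  sat (Ex phi) e = [exists x, sat phi (oapp e x)].
Proof. by []. Qed.

Lemma sat_rename (M : structure L) (V W : Type) (f : V -> W) (phi : formula L V)
    (e : W -> M) :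
  sat (rename f phi) e = sat phi (e \o f).
Proof.
elim: phi W f e => [{}V|{}V x y|{}V P t|{}V psi IH|{}V psi1 IH1 psi2 IH2|{}V psi IH]
  W f e //=.
- by congr holds; apply: val_inj; rewrite /= -map_comp.
- by rewrite IH.
- by rewrite IH1 IH2.
- apply: eq_existsb => x; rewrite IH; congr sat.
  by apply/funext => -[].
Qed.

Lemma in_solutions (M : structure L) (V : Type) (phi : formula L (option V))
    (b : V -> M) :
  solutions phi b =i [pred x | sat phi (oapp b x)].
Proof. by move=> x; rewrite !inE. Qed.

(** * Derived connectives and block quantifiers *)

Definition Top (V : Type) : formula L V := Not (@Bot L V).
Definition Or (V : Type) (phi psi : formula L V) : formula L V :=
  Not (And (Not phi) (Not psi)).
Definition BigAnd (T V : Type) (s : seq T) (F : T -> formula L V) : formula L V :=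
  foldr (fun x phi => And (F x) phi) (Top V) s.
Definition BigOr (T V : Type) (s : seq T) (F : T -> formula L V) : formula L V :=
  foldr (fun x phi => Or (F x) phi) (@Bot L V) s.

Lemma sat_BigAnd (M : structure L) (T V : Type) (s : seq T) (F : T -> formula L V)
    (e : V -> M) :
  sat (BigAnd s F) e = all (fun x => sat (F x) e) s.
Proof. by elim: s => //= x s ->. Qed.

Lemma sat_BigOr (M : structure L) (T V : Type) (s : seq T) (F : T -> formula L V)
    (e : V -> M) :
  sat (BigOr s F) e = has (fun x => sat (F x) e) s.
Proof. by elim: s => //= x s ->; rewrite negb_and !negbK. Qed.

Definition env_sum (M V T : Type) (b : V -> M) (f : T -> M) (x : V + T) : M :=
  match x with inl v => b v | inr i => f i end.

Definition unsum0 (V : Type) (x : V + 'I_0) : V :=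
  match x with
  | inl v => v
  | inr (Ordinal m lt_m0) => False_rect V (notF lt_m0)
  end.

Definition unsumS (V : Type) (n : nat) (x : V + 'I_n.+1) : option (V + 'I_n) :=
  match x with
  | inl v => Some (inl v)
  | inr i => omap inr (unlift ord0 i)
  end.

Lemma env_sum0 (M V : Type) (b : V -> M) (f : 'I_0 -> M) :
  b \o @unsum0 V = env_sum b f.
Proof. by apply/funext => -[//|[]]. Qed.

Lemma env_sumS (M V : Type) (n : nat) (b : V -> M) (f : 'I_n.+1 -> M) :
  oapp (env_sum b (f \o lift ord0)) (f ord0) \o @unsumS V n = env_sum b f.
Proof. by apply/funext => -[//|i] /=; case: unliftP => [j|] ->. Qed.

(** Each step lets [Ex] bind index [0] and shifts the other indices down; at [n = 0] the index type
    is empty and a renaming is enough. *)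
Fixpoint ExsI (V : Type) (n : nat) : formula L (V + 'I_n) -> formula L V :=
  match n with
  | 0 => rename (@unsum0 V)
  | n.+1 => fun phi => ExsI (Ex (rename (@unsumS V n) phi))
  end.

Lemma sat_ExsI (M : structure L) (V : Type) (n : nat) (phi : formula L (V + 'I_n))
    (b : V -> M) :
  sat (ExsI phi) b <-> exists f : 'I_n -> M, sat phi (env_sum b f).
Proof.
elim: n phi => [|n IH] phi.
  rewrite [ExsI _]/= sat_rename; split => [h|[f]]; last by rewrite -env_sum0.
  have f : 'I_0 -> M by case.
  by exists f; rewrite -env_sum0.
split=> [/IH[f]|[f h]].
  rewrite sat_Ex => /existsP[x]; rewrite sat_rename => h.
  exists (fun i => oapp f x (unlift ord0 i)).
  rewrite -env_sumS unlift_none /=; congr (is_true (sat phi _)): h.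
  congr (oapp (env_sum b _) _ \o _).
  by apply/funext => j /=; rewrite liftK.
apply/IH; exists (f \o lift ord0); rewrite sat_Ex; apply/existsP; exists (f ord0).
by rewrite sat_rename env_sumS.
Qed.

Definition Exs (V : Type) (T : finType) (phi : formula L (V + T)) : formula L V :=
  ExsI (rename (fun x => match x with
                         | inl v => inl v
                         | inr i => inr (enum_rank i) end) phi).

Lemma sat_Exs (M : structure L) (V : Type) (T : finType) (phi : formula L (V + T))
    (b : V -> M) :
  sat (Exs phi) b <-> exists f : T -> M, sat phi (env_sum b f).
Proof.
rewrite /Exs; split=> [/sat_ExsI[f]|[f h]].
  rewrite sat_rename => h; exists (f \o enum_rank).
  by congr (is_true (sat phi _)): h; apply/funext => -[].
apply/sat_ExsI; exists (f \o enum_val).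
rewrite sat_rename; congr (is_true (sat phi _)): h.
by apply/funext => -[//|i] /=; rewrite enum_rankK.
Qed.

End Formulas.

(** * Asymptotic estimates along a size function *)

Section Asymptotics.
Variable R : realType.
Import Order.TTheory GRing.Theory Num.Theory numFieldNormedType.Exports.
Local Open Scope classical_set_scope.
Local Open Scope ring_scope.

(** The filter generated by the values of [f] on the [i] in [Phi] of large size.
    It is pushed forward to [T] because classes of structures live in a universe
    too large for the filters of the library. *)
Definition tail (I T : Type) (size : I -> nat) (Phi : I -> Prop) (f : I -> T) :
    set_system T :=
  [set S | exists Q : nat, forall i, Phi i -> (Q < size i)%N -> S (f i)].

Global Instance tail_filter (I T : Type) (size : I -> nat) (Phi : I -> Prop)
  (f : I -> T) : Filter (tail size Phi f).
Proof.
split; first by exists 0%N.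
- move=> S S' [Q1 h1] [Q2 h2]; exists (maxn Q1 Q2) => i Pi; rewrite gtn_max.
  by case/andP=> l1 l2; split; [apply: h1|apply: h2].
- by move=> S S' SS' [Q h]; exists Q => i Pi l; apply/SS'/h.
Qed.

(** The base [t = |M| ^ (1 / N)] turns every gauge [|M| ^ (d / N)] into an integer power of [t], so
    exponents can be added, negated and compared as integers. *)
Definition root_size (N n : nat) : R := n%:R `^ N%:R^-1.

Lemma root_size_gt0 (N n : nat) : (0 < n)%N -> 0 < root_size N n.
Proof. by move=> n0; rewrite powR_gt0 // ltr0n. Qed.

Lemma root_size_exp (N n e : nat) : root_size N n ^+ e = n%:R `^ (e%:R / N%:R).
Proof. by rewrite -powR_mulrn ?powR_ge0 // /root_size -powRrM mulrC. Qed.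

Lemma root_size_cvg (N : nat) (I T : Type) (size : I -> nat) (Phi : I -> Prop)
    (f : I -> T) (g : T -> nat) :
  (0 < N)%N -> (forall i, g (f i) = size i) ->
  (root_size N (g x))^-1 @[x --> tail size Phi f] --> (0 : R).
Proof.
move=> N0 gf; apply/cvgr0Pnorm_le => eps eps0.
(* A size above [eps ^ (- N)] has an [N]-th root above [1 / eps]. *)
exists (Num.truncn (eps^-1 ^+ N)).+1 => i _ lti; rewrite gf.
have s0 : 0 < (size i)%:R :> R by rewrite ltr0n (leq_trans _ lti).
rewrite ger0_norm ?invr_ge0 ?powR_ge0 // invf_ple ?posrE ?powR_gt0 //.
have -> : eps^-1 = (eps^-1 ^+ N) `^ N%:R^-1.
  rewrite -powR_mulrn ?invr_ge0 ?ltW // -powRrM divff ?powRr1 ?invr_ge0 ?ltW //.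
  by rewrite pnatr_eq0 -lt0n.
rewrite ge0_ler_powR ?nnegrE ?exprn_ge0 ?invr_ge0 ?ltW //; first by rewrite ltr0n.
by rewrite (lt_trans (truncnS_gt _)) // ltr_nat.
Qed.

(** [None] stands for an eventually vanishing [h], the estimate [(0, 0)].
    Exponents are integers because inverse class sizes have negative ones. *)
Definition asym (I : Type) (F : set_system I) (t h : I -> R)
    (c : option (int * R)) : Prop :=
  match c with
  | None => \forall i \near F, h i = 0
  | Some (d, mu) => 0 < mu /\ h i * t i ^ (- d) @[i --> F] --> mu
  end.

(** * Calculus of estimates along an abstract filter *)

Section Base.
Variables (I : Type) (F : set_system I) (t : I -> R).
Context {FF : Filter F}.
Hypothesis t_gt0 : \forall i \near F, 0 < t i.
Hypothesis t_cvg : (t i)^-1 @[i --> F] --> (0 : R).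

Lemma exprz_cvg0 (d : int) : d < 0 -> t i ^ d @[i --> F] --> (0 : R).
Proof.
case: d => // n _.
suff : (t i)^-1 ^+ n.+1 @[i --> F] --> (0 : R).
  by apply: cvg_trans; apply: near_eq_cvg; near=> i; rewrite NegzE exprVn.
have := cvg_comp _ _ t_cvg (@exprn_continuous R n.+1 0).
by rewrite expr0n.
Unshelve. all: by end_near. Qed.

Lemma asym_near (h h' : I -> R) c :
  (\forall i \near F, h i = h' i) -> asym F t h c -> asym F t h' c.
Proof.
move=> hh'; case: c => [[d mu]|] /=.
  move=> [mu0 hmu]; split=> //; apply: cvg_trans hmu; apply: near_eq_cvg.
  by near=> i; rewrite (near hh' i).
by move=> h0; near=> i; rewrite -(near hh' i) // (near h0 i).
Unshelve. all: by end_near. Qed.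

Lemma asym_dominated (h : I -> R) (d d' : int) (mu : R) :
  d < d' -> h i * t i ^ (- d) @[i --> F] --> mu ->
  h i * t i ^ (- d') @[i --> F] --> (0 : R).
Proof.
move=> dd' hmu; rewrite -(mulr0 mu).
have lt0 : d - d' < 0 by rewrite subr_lt0.
apply: cvg_trans (cvgM hmu (exprz_cvg0 lt0)).
apply: near_eq_cvg; near=> i => /=.
have ti : t i != 0 by rewrite gt_eqF //; near: i.
by rewrite -mulrA -expfzDr // addrA addNr add0r.
Unshelve. all: by end_near. Qed.

(** The larger exponent dominates. At equal exponents the coefficients add, and their positivity
    rules out cancellation of the leading terms. *)
Lemma asymD (h1 h2 : I -> R) c1 c2 :
  asym F t h1 c1 -> asym F t h2 c2 -> exists c, asym F t (fun i => h1 i + h2 i) c.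
Proof.
case: c2 => [[d2 mu2]|] a1 a2; last first.
  exists c1; apply: asym_near a1; near=> i.
  by rewrite (near a2 i) // addr0.
case: c1 a1 => [[d1 mu1]|] a1; last first.
  exists (Some (d2, mu2)); apply: asym_near a2; near=> i.
  by rewrite (near a1 i) // add0r.
case: a1 a2 => p1 c1 [p2 c2].
have [lt12|lt21|e12] := ltgtP d1 d2.
- exists (Some (d2, mu2)); split=> //; rewrite -[mu2]add0r.
  under eq_cvg do rewrite mulrDl.
  by apply: cvgD => //; apply: asym_dominated c1.
- exists (Some (d1, mu1)); split=> //; rewrite -[mu1]addr0.
  under eq_cvg do rewrite mulrDl.
  by apply: cvgD => //; apply: asym_dominated c2.
- exists (Some (d2, mu1 + mu2)); split; first exact: addr_gt0.
  under eq_cvg do rewrite mulrDl.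
  by apply: cvgD => //; rewrite -e12.
Unshelve. all: by end_near. Qed.

(** The exponent changes sign; an eventually vanishing function stays so by the convention
    [0^-1 = 0]. *)
Lemma asymV (h : I -> R) c :
  asym F t h c -> exists c', asym F t (fun i => (h i)^-1) c'.
Proof.
case: c => [[d mu]|]; last first.
  by move=> h0; exists None; near=> i; rewrite (near h0 i) // invr0.
move=> [mu0 hmu]; exists (Some (- d, mu^-1)); split; first by rewrite invr_gt0.
have mun : mu != 0 by rewrite gt_eqF.
apply: cvg_trans (cvgV mun hmu); apply: near_eq_cvg; near=> i => /=.
by rewrite invfM invr_expz.
Unshelve. all: by end_near. Qed.

(** The case in view is a sum [h] of [f] many terms, each uniformly close to [mu * t ^ d]. The error
    is relative to [f]: it disappears in the limit if [f ~ nu * t ^ e], and it forces [h = 0] where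
    [f = 0]. *)
Lemma asym_mul_approx (h f : I -> R) (d : int) (mu : R) c :
  0 < mu -> asym F t f c ->
  (forall eps, 0 < eps ->
     \forall i \near F, `|h i * t i ^ (- d) - mu * f i| <= eps * f i) ->
  exists c', asym F t h c'.
Proof.
move=> mu0 fc hf; case: c fc => [[e nu] [nu0 fnu]|f00]; last first.
  exists None; near=> i.
  have fi : f i = 0 by near: i.
  have /= : `|h i * t i ^ (- d) - mu * f i| <= 1 * f i by near: i; apply: hf.
  rewrite fi !mulr0 subr0 normr_le0 mulf_eq0 expfz_eq0 => /orP[/eqP//|].
  have /gt_eqF-> : 0 < t i by near: i.
  by rewrite andbF.
exists (Some (d + e, mu * nu)); split; first exact: mulr_gt0.
have mufnu : mu * (f i * t i ^ (- e)) @[i --> F] --> mu * nu.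
  by apply: cvgM => //; apply: cvg_cst.
rewrite -[mu * nu]addr0.
suff : h i * t i ^ (- (d + e)) - mu * (f i * t i ^ (- e)) @[i --> F] --> (0 : R).
  move=> k; apply: cvg_trans (cvgD mufnu k).
  by apply: near_eq_cvg; near=> i => /=; rewrite addrC subrK.
apply/cvgr0Pnorm_le => eps eps0.
have fle : \forall i \near F, f i * t i ^ (- e) < nu + 1.
  by apply: (cvgr_lt nu) => //; rewrite ltrDl.
(* Since [f * t ^ (- e)] is eventually below [nu + 1], this relative error amounts to an absolute
   error of at most [eps]. *)
have e1 : 0 < eps / (nu + 1) by rewrite divr_gt0 // addr_gt0.
near=> i => /=.
have ti : 0 < t i by near: i.
have te : 0 < t i ^ (- e) by rewrite exprz_gt0.
rewrite opprD expfzDr ?gt_eqF // !mulrA -mulrBl normrM (gtr0_norm te).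
have le1 : `|h i * t i ^ (- d) - mu * f i| <= eps / (nu + 1) * f i.
  by near: i; apply: hf.
apply: le_trans (ler_wpM2r (ltW te) le1) _.
have le2 : f i * t i ^ (- e) <= nu + 1 by apply: ltW; near: i.
rewrite -[_ * f i * _]mulrA; apply: le_trans (ler_wpM2l (ltW e1) le2) _.
by rewrite divfK // gt_eqF // addr_gt0.
Unshelve. all: by end_near. Qed.

(** A natural number below [1] is [0], which excludes negative exponents; comparison with [B]
    excludes those above [e]. *)
Lemma asym_nat_bounded (k B : I -> nat) c (e : nat) (lambda : R) :
  asym F t (fun i => (k i)%:R) c ->
  (B i)%:R * t i ^ (- e%:Z) @[i --> F] --> lambda ->
  (\forall i \near F, k i <= B i)%N ->
  (\forall i \near F, k i = 0%N) \/
  exists2 f : nat, (f <= e)%N &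
    exists2 nu : R, 0 < nu & (k i)%:R * t i ^ (- f%:Z) @[i --> F] --> nu.
Proof.
move=> kc Be kB; case: c kc => [[d nu] [nu0 knu]|k0]; last first.
  by left; near=> i; apply/eqP; rewrite -(pnatr_eq0 R); apply/eqP; near: i.
have [d0|d0] := ltP d 0.
  left.
  have := asym_dominated d0 knu; under eq_cvg do rewrite oppr0 mulr1.
  move=> /cvgr_lt/(_ _ ltr01) k1; near=> i.
  by have : (k i)%:R < 1 :> R; [near: i | rewrite -[1]/1%:R ltr_nat ltnS leqn0 => /eqP].
case: d d0 knu => // f _ knu.
have [lef|ltf] := leqP f e; first by right; exists f => //; exists nu.
left.
have ltz : (e%:Z < f%:Z) by rewrite ltz_nat.
have nu2 : nu / 2 < nu by rewrite ltr_pdivrMr // ltr_pMr // ltr1n.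
have nu20 : 0 < nu / 2 by rewrite divr_gt0.
have /cvgr_lt/(_ _ nu20) B2 := asym_dominated ltz Be.
have /cvgr_gt/(_ _ nu2) k1 := knu.
(* The two bounds contradict [k <= B] at every late point. As [F] may be improper, this gives
   eventual vanishing and not an outright contradiction. *)
near=> i; exfalso.
have ti : 0 < t i by near: i.
have : nu / 2 < (k i)%:R * t i ^ (- f%:Z) by near: i.
apply/negP; rewrite -leNgt.
have : (B i)%:R * t i ^ (- f%:Z) < nu / 2 by near: i.
move=> /ltW; apply: le_trans; rewrite ler_pM2r ?exprz_gt0 // ler_nat.
by near: i.
Unshelve. all: by end_near. Qed.

End Base.

(** * Estimates along the sizes of an indexed family *)

Section Tail.
Variables (I : Type) (size : I -> nat) (N : nat).
Hypothesis N_gt0 : (0 < N)%N.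
Implicit Types (Phi : I -> Prop) (h : I -> R).

Definition asym_at Phi h (c : option (int * R)) : Prop :=
  asym (tail size Phi (fun i => (size i, h i))) (fun x => root_size N x.1)
    (fun x => x.2) c.

Lemma root_size_tail_gt0 (T : Type) Phi (f : I -> T) (g : T -> nat) :
  (forall i, g (f i) = size i) ->
  \forall x \near tail size Phi f, 0 < root_size N (g x).
Proof. by move=> gf; exists 0%N => i _ lti; rewrite gf root_size_gt0. Qed.

Lemma asym_atD Phi h1 h2 c1 c2 :
  asym_at Phi h1 c1 -> asym_at Phi h2 c2 ->
  exists c, asym_at Phi (fun i => h1 i + h2 i) c.
Proof.
(* The size and both functions are pushed forward together, so that the two estimates live on one
   filter. *)
pose f i := (size i, h1 i, h2 i) => a1 a2.
have [] := @asymD (nat * R * R)%type (tail size Phi f) (fun x => root_size N x.1.1) _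
  _ _ (fun x => x.1.2) (fun x => x.2) c1 c2.
- exact: root_size_tail_gt0.
- exact: root_size_cvg.
- by case: (c1) a1 => [[]|].
- by case: (c2) a2 => [[]|].
- by move=> c ac; exists c; case: c ac => [[]|].
Qed.

Lemma asym_atV Phi h c :
  asym_at Phi h c -> exists c', asym_at Phi (fun i => (h i)^-1) c'.
Proof.
by move=> /asymV[c' ac']; exists c'; case: c' ac' => [[]|].
Qed.

Lemma asym_at_mul_approx Phi h f d mu c :
  0 < mu -> asym_at Phi f c ->
  (forall eps, 0 < eps -> exists Q : nat, forall i, Phi i -> (Q < size i)%N ->
     `|h i * root_size N (size i) ^ (- d) - mu * f i| <= eps * f i) ->
  exists c', asym_at Phi h c'.
Proof.
pose g i := (size i, h i, f i) => mu0 af hf.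
have [] := @asym_mul_approx (nat * R * R)%type (tail size Phi g)
  (fun x => root_size N x.1.1) _ _ (fun x => x.1.2) (fun x => x.2) d mu c mu0.
- exact: root_size_tail_gt0.
- by case: (c) af => [[]|].
- exact: hf.
- by move=> c' ac'; exists c'; case: c' ac' => [[]|].
Qed.

End Tail.

(** An estimate only sees the pairs of size and value. Passing to a subcell, renaming variables and
    changing the index type are all instances. *)
Lemma asym_at_transfer (I J : Type) (size : I -> nat) (size' : J -> nat) (N : nat)
    (Phi : I -> Prop) (Psi : J -> Prop) (h : I -> R) (h' : J -> R) c :
  (forall j, Psi j -> exists i, [/\ Phi i, size i = size' j & h i = h' j]) ->
  asym_at size N Phi h c -> asym_at size' N Psi h' c.
Proof.
move=> tr; case: c => [[d mu] [mu0 hmu]|[Q hQ]]; last first.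
  by exists Q => j /tr[i [Pi <- <-]]; apply: hQ.
split=> // S /hmu[Q hQ]; exists Q => j /tr[i [Pi <- <-]].
exact: hQ.
Qed.

(** Among admissible pairs only [(0, 0)] has second component [0]. *)
Definition asym_code (p : nat * R) : option (int * R) :=
  if p.2 == 0 then None else Some (Posz p.1, p.2).

(** Division by the gauge turns the little-o estimate into a limit. For [(0, 0)] the count is a
    natural number, so [o(1)] means eventually [0]. *)
Lemma littleo_asym_at (I : Type) (size count : I -> nat) (N K : nat) (Phi : I -> Prop)
    (p : nat * R) :
  admissible K p ->
  let g := fun i => (size i)%:R `^ (p.1%:R / N%:R) in
  uniform_littleo size Phi (fun i => (count i)%:R - p.2 * g i) g <->
  asym_at size N Phi (fun i => (count i)%:R) (asym_code p).
Proof.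
rewrite /asym_code => -[[_ p2]|->] /=; last first.
  rewrite eqxx; split=> [lo|[Q hQ] eps eps0]; last first.
    exists Q => i Pi lti; have /= c0 := hQ i Pi lti.
    by rewrite mul0r subr0 mul0r powRr0 mulr1 c0 normr0 ltW.
  have [Q hQ] := lo (1 / 2) ltac:(by rewrite divr_gt0).
  exists Q => i Pi lti; have := hQ i Pi lti.
  rewrite mul0r subr0 mul0r powRr0 mulr1 ger0_norm // => le.
  have : (count i)%:R < 1 :> R.
    by rewrite (le_lt_trans le) // ltr_pdivrMr // mul1r ltr1n.
  by rewrite -[1]/1%:R ltr_nat ltnS leqn0 => /eqP->.
rewrite gt_eqF //.
have dist i eps : (0 < size i)%N ->
    (`|p.2 - (count i)%:R * root_size N (size i) ^ (- (Posz p.1))| <= eps) =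
    (`|(count i)%:R - p.2 * (size i)%:R `^ (p.1%:R / N%:R)| <=
     eps * (size i)%:R `^ (p.1%:R / N%:R)).
  move=> si; rewrite -root_size_exp.
  have r0 : 0 < root_size N (size i) ^+ p.1 by rewrite exprn_gt0 // root_size_gt0.
  rewrite -invr_expz -exprnP distrC.
  by rewrite -(ler_pM2r r0) -{2}(gtr0_norm r0) -normrM mulrBl divfK ?gt_eqF.
split=> [lo|[_ /cvgrPdist_le cv] eps /cv[Q hQ]].
  split=> //; apply/cvgrPdist_le => eps /lo[Q hQ]; exists Q => i Pi lti /=.
  by rewrite dist ?hQ // (leq_ltn_trans _ lti).
exists Q => i Pi lti; have := hQ i Pi lti; rewrite /= dist //.
exact: leq_ltn_trans lti.
Qed.

End Asymptotics.

(** * Estimable functions on an asymptotic class *)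

Section Estimable.
Import Order.TTheory GRing.Theory Num.Theory numFieldNormedType.Exports.
Local Open Scope classical_set_scope.
Local Open Scope ring_scope.
Variables (R : realType) (L : language) (C : structure_class L) (N : nat).

Definition env_index (V : Type) : Type := {M : {M : structure L | C M} & V -> sval M}.

Definition mk_env (V : Type) (M : {M : structure L | C M}) (e : V -> sval M) :
  env_index V := existT (fun M : {M : structure L | C M} => V -> sval M) M e.

Definition env_size (V : Type) (i : env_index V) : nat := #|sval (tag i)|.

Definition asym_cell (V : Type) (theta : formula L V) (h : env_index V -> R)
    (c : option (int * R)) : Prop :=
  asym_at (@env_size V) N (fun i => sat theta (tagged i)) h c.

(** Cells are indexed by any finite type and not by their estimates: distinct cells may share an
    estimate, and partitions can be refined by products. *)
Definition estimable (V : Type) (h : env_index V -> R) : Prop :=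
  exists (K : finType) (theta : K -> formula L V),
    (forall i : env_index V, #|[pred k | sat (theta k) (tagged i)]| = 1%N) /\
    forall k, exists c, asym_cell (theta k) h c.

Hypothesis N_gt0 : (0 < N)%N.

Lemma asym_cell_sub (V : Type) (theta theta' : formula L V) h c :
  (forall i : env_index V, sat theta' (tagged i) -> sat theta (tagged i)) ->
  asym_cell theta h c -> asym_cell theta' h c.
Proof. by move=> sub; apply: asym_at_transfer => i /sub; exists i. Qed.

Lemma estimable_ext (V : Type) (h h' : env_index V -> R) :
  h =1 h' -> estimable h -> estimable h'.
Proof.
move=> hh' [K [theta [p a]]]; exists K, theta; split=> // k.
have [c ac] := a k; exists c.
by apply: asym_at_transfer ac => i; exists i.
Qed.

Lemma estimable0 (V : Type) : estimable (fun _ : env_index V => 0).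
Proof.
exists unit, (fun=> Top L V); split=> [i|k]; last by exists None; exists 0%N.
by rewrite (eq_card (B := predT)) ?card_unit // => -[].
Qed.

Lemma estimable_indicator (V : Type) (phi : formula L V) :
  estimable (fun i : env_index V => (sat phi (tagged i))%:R).
Proof.
exists bool, (fun b : bool => if b then phi else Not phi); split=> [i|[]].
- rewrite (eq_card (B := pred1 (sat phi (tagged i)))) ?card1 // => -[];
  by rewrite !inE /=; case: (sat _ _).
- exists (Some (0, 1)); split=> // S /nbhs_singleton S1; exists 0%N => i /= -> _.
  by rewrite oppr0 mulr1.
- by exists None; exists 0%N => i /= /negbTE->.
Qed.

Lemma estimableD (V : Type) (h1 h2 : env_index V -> R) :
  estimable h1 -> estimable h2 -> estimable (fun i => h1 i + h2 i).
Proof.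
move=> [K1 [t1 [p1 a1]]] [K2 [t2 [p2 a2]]].
exists (K1 * K2)%type, (fun k => And (t1 k.1) (t2 k.2)); split=> [i|[k1 k2]].
  rewrite -[RHS]muln1 -{1}(p1 i) -(p2 i) -cardX.
  by apply: eq_card => -[k1 k2]; rewrite !inE.
have [c1 e1] := a1 k1; have [c2 e2] := a2 k2.
apply: asym_atD => //.
- by apply: asym_cell_sub e1 => i /= /andP[].
- by apply: asym_cell_sub e2 => i /= /andP[].
Qed.

Lemma estimable_sum (V : Type) (T : finType) (h : T -> env_index V -> R) :
  (forall x, estimable (h x)) -> estimable (fun i => \sum_x h x i).
Proof.
move=> hx; suff : forall s : seq T, estimable (fun i => \sum_(x <- s) h x i) by apply.
elim=> [|x s IH].
  by apply: estimable_ext (@estimable0 V) => i; rewrite big_nil.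
by apply: estimable_ext (estimableD (hx x) IH) => i; rewrite big_cons.
Qed.

Lemma estimableV (V : Type) (h : env_index V -> R) :
  estimable h -> estimable (fun i => (h i)^-1).
Proof.
move=> [K [theta [p a]]]; exists K, theta; split=> // k.
by have [c /asym_atV] := a k.
Qed.

Lemma estimable_rename (V W : Type) (f : V -> W) (h : env_index V -> R) :
  estimable h -> estimable (fun i : env_index W => h (mk_env (tagged i \o f))).
Proof.
move=> [K [theta [p a]]]; exists K, (fun k => rename f (theta k)); split=> [i|k].
  rewrite -(p (mk_env (tagged i \o f))).
  by apply: eq_card => k; rewrite !inE /= sat_rename.
have [c e] := a k; exists c.
apply: asym_at_transfer e => i; rewrite sat_rename => si.
by exists (mk_env (tagged i \o f)).
Qed.

(** * Counting and summation over variables *)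

Hypothesis asymC : asymptotic_class R N C.

(** The definition of an asymptotic class speaks of parameter tuples; enumerating [V] carries it
    over to assignments, with the members of [D] as cell indices. *)
Lemma estimable_count (V : finType) (phi : formula L (option V)) :
  estimable (fun i => #|solutions phi (tagged i)|%:R).
Proof.
have [_ /(_ _ (rename (omap (@enum_rank V)) phi))[D [theta [adm part est]]]] := asymC.
pose b (i : env_index V) := mktuple (tagged i \o @enum_val V predT).
have tb i : tnth (b i) \o enum_rank = tagged i.
  by apply/funext => x; rewrite /= tnth_mktuple /= enum_rankK.
pose J := {M : {M : structure L | C M} & #|V|.-tuple (sval M)}.
pose j (i : env_index V) : J := Tagged (fun M : {M | C M} => #|V|.-tuple (sval M)) (b i).
pose th (p : seq_sub D) := rename (@enum_val V predT) (theta (ssval p)).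
have sth p i : sat (th p) (tagged i) = sat (theta (ssval p)) (tnth (b i)).
  rewrite sat_rename; congr sat.
  by apply/funext => x; rewrite /= tnth_mktuple.
exists (seq_sub D), th; split.
  move=> i; have [p [[pD sp] up]] := part (j i).
  apply/eqP/card1P; exists (SeqSub pD) => q; rewrite !inE sth.
  apply/idP/eqP => [sq|-> //].
  by apply/val_inj/esym/up; split=> //; apply: (ssvalP q).
move=> p; exists (asym_code (ssval p)).
have /(littleo_asym_at _ _ _ _ (adm _ (ssvalP p))) := est _ (ssvalP p).
apply: asym_at_transfer => i; rewrite sth => si; exists (j i); split=> //.
congr (_%:R); apply: eq_card => x; rewrite !inE sat_rename; congr sat.
by apply/funext => -[y|//] /=; rewrite -[in RHS](tb i).
Qed.

(** The values [x] are grouped by the cell that they form together with the parameters. On one group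
    [h] is uniformly close to [mu * t ^ d], and the size of the group is estimable because the cell
    is definable. *)
Lemma estimable_sum1 (V : finType) (h : env_index (option V) -> R) :
  estimable h ->
  estimable (fun i : env_index V =>
    \sum_(x : sval (tag i)) h (mk_env (oapp (tagged i) x))).
Proof.
move=> [K [theta [p a]]].
pose S k (i : env_index V) :=
  \sum_(x | sat (theta k) (oapp (tagged i) x)) h (mk_env (oapp (tagged i) x)).
apply: (@estimable_ext _ (fun i => \sum_k S k i)).
  move=> i; rewrite /S (exchange_big_dep predT) //=; apply: eq_bigr => x _.
  by rewrite sumr_const (p (mk_env (oapp (tagged i) x))).
apply: estimable_sum => k.
have [c hc] := a k; have [K' [theta' [p' a']]] := estimable_count (theta k).
exists K', theta'; split=> // k'; have {a'}[c' ec'] := a' k'.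
case: c hc => [[d mu] [mu0 hmu]|[Q hQ]]; last first.
  exists None; exists Q => i _ lti; rewrite /S big1 // => x sx.
  exact: (hQ (mk_env (oapp (tagged i) x))).
apply: (asym_at_mul_approx (d := d) mu0 ec') => eps eps0.
(* One threshold serves all [x], since extending an assignment by [x] leaves the ambient structure
   unchanged. *)
have /cvgrPdist_le/(_ _ eps0)[Q hQ] := hmu.
exists Q => i _ lti; rewrite /S mulr_suml.
rewrite -sum1_card natr_sum !(eq_bigl _ _ (in_solutions _ _)) !mulr_sumr -sumrB.
apply: le_trans (ler_norm_sum _ _ _) _; apply: ler_sum => x sx.
rewrite !mulr1 distrC.
exact: (hQ (mk_env (oapp (tagged i) x))).
Qed.

Lemma estimable_sum_tuple (V : finType) (n : nat) (h : env_index (V + 'I_n) -> R) :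
  estimable h ->
  estimable (fun i : env_index V =>
    \sum_(u : n.-tuple (sval (tag i))) h (mk_env (env_sum (tagged i) (tnth u)))).
Proof.
elim: n h => [|n IH] h hest.
  apply: estimable_ext (estimable_rename (@unsum0 V) hest) => i.
  rewrite (big_pred1 [tuple]) => [|u]; last exact/esym/eqP/tuple0.
  by rewrite (env_sum0 _ (tnth [tuple])).
apply: estimable_ext (IH _ (estimable_sum1 (estimable_rename (@unsumS V n) hest))) => i.
rewrite (reindex (fun xu : sval (tag i) * n.-tuple (sval (tag i)) =>
                    [tuple of xu.1 :: xu.2])) /=; last first.
  exists (fun u => (thead u, [tuple of behead u])) => [[x u] _|u _].
    by congr pair; apply: val_inj.
  by rewrite [RHS]tuple_eta.
rewrite exchange_big pair_bigA /=; apply: eq_bigr => -[x u] _ /=.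
congr (h (mk_env _)); rewrite -env_sumS tnth0; congr (oapp (env_sum _ _) _ \o _).
by apply/funext => j /=; rewrite tnthS.
Qed.

End Estimable.

(** * Translation through an interpretation *)

Section Translation.
Import GRing.Theory Num.Theory.
Variables (L L' : language) (C : structure_class L) (D : structure_class L').
Variables (r : nat) (I : interpretation_data C D r).
Notation s := (i_npar I).

Definition env_reps (V : Type) (A : {A | D A}) (v : V -> r.-tuple (i_target I A))
    (x : V * 'I_r + 'I_s) : i_target I A :=
  match x with inl (y, j) => tnth (v y) j | inr k => tnth (i_par I A) k end.

Definition plug (V : Type) (m : nat) (t : m.-tuple V) (rho : formula L (tvars m r s)) :
    formula L (V * 'I_r + 'I_s) :=
  rename (fun x => match x with
                   | inl (i, j) => inl (tnth t i, j)
                   | inr k => inr k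
                   end) rho.

Lemma sat_plug (V : Type) (A : {A | D A}) (v : V -> r.-tuple (i_target I A))
    (m : nat) (t : m.-tuple V) (rho : formula L (tvars m r s)) :
  sat (plug t rho) (env_reps v) = i_sat rho (map_tuple v t).
Proof.
rewrite sat_rename; congr sat.
by apply/funext => -[[i j]|k] //=; rewrite tnth_map.
Qed.

Definition split_last (V : Type) (x : option V * 'I_r + 'I_s) :
    (V * 'I_r + 'I_s) + 'I_r :=
  match x with
  | inl (Some y, j) => inl (inl (y, j))
  | inl (None, j) => inr j
  | inr k => inl (inr k)
  end.

Lemma env_split_last (V : Type) (A : {A | D A}) (v : V -> r.-tuple (i_target I A))
    (f : 'I_r -> i_target I A) :
  env_sum (env_reps v) f \o @split_last V = env_reps (oapp v (mktuple f)).
Proof. by apply/funext => -[[[y|] j]|k] //=; rewrite tnth_mktuple. Qed.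

Definition in_X (V : Type) (x : V) : formula L (V * 'I_r + 'I_s) :=
  plug [tuple x] (i_delta I).

Lemma sat_in_X (V : Type) (A : {A | D A}) (v : V -> r.-tuple (i_target I A)) (x : V) :
  sat (in_X x) (env_reps v) = (v x \in i_X I A).
Proof. by rewrite sat_plug inE; congr i_sat; apply: val_inj. Qed.

Fixpoint translate (V : Type) (phi : formula L' V) : formula L (V * 'I_r + 'I_s) :=
  match phi with
  | Bot => @Bot L _
  | Eq x y => plug [tuple x; y] (i_epsilon I)
  | Atom P t => plug t (i_pred I P)
  | Not psi => Not (translate psi)
  | And psi1 psi2 => And (translate psi1) (translate psi2)
  | Ex psi => Exs (rename (@split_last V) (And (in_X None) (translate psi)))
  end.

Lemma translate_Ex (V : Type) (psi : formula L' (option V)) :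
  translate (Ex psi) = Exs (rename (@split_last V) (And (in_X None) (translate psi))).
Proof. by []. Qed.

Definition represents (V : Type) (A : {A | D A}) (v : V -> r.-tuple (i_target I A))
    (a : V -> sval A) : Prop :=
  forall x, v x \in i_iota I (a x).

Hypothesis II : is_interpretation I.

Lemma iota_partition (A : {A | D A}) :
  finset.partition [set i_iota I a | a : sval A]%SET (i_X I A).
Proof.
by rewrite (i_iota_image II); apply: equivalence_partitionP; apply: i_equiv II A.
Qed.

Lemma iota_in_X (A : {A | D A}) (a : sval A) u : u \in i_iota I a -> u \in i_X I A.
Proof.
move=> ua; rewrite -(cover_partition (iota_partition A)).
by apply/bigcupP; exists (i_iota I a) => //; apply: imset_f.
Qed.

Lemma X_in_iota (A : {A | D A}) u : u \in i_X I A -> exists a : sval A, u \in i_iota I a.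
Proof.
rewrite -(cover_partition (iota_partition A)).
by move=> /bigcupP[B /imsetP[a _ ->] ua]; exists a.
Qed.

Lemma iota_nonempty (A : {A | D A}) (a : sval A) : exists u, u \in i_iota I a.
Proof.
apply/set0Pn/negP => /eqP e0.
by have := partition0 (iota_partition A); rewrite -e0 imset_f.
Qed.

Lemma iota_disjoint (A : {A | D A}) (a b : sval A) u :
  u \in i_iota I a -> u \in i_iota I b -> a = b.
Proof.
move=> ua ub; apply: (i_iota_inj II).
have tr := partition_trivIset (iota_partition A).
by rewrite -(def_pblock tr (imset_f _ isT) ua) (def_pblock tr (imset_f _ isT) ub).
Qed.

Lemma E_iota (A : {A | D A}) (a : sval A) u w :
  u \in i_iota I a -> w \in i_X I A -> i_E u w = (w \in i_iota I a).
Proof.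
move=> ua wX; have uX := iota_in_X ua.
have tr := partition_trivIset (iota_partition A).
rewrite -(def_pblock tr (imset_f _ isT) ua) (i_iota_image II).
by rewrite (pblock_equivalence_partition (i_equiv II (A := A))).
Qed.

Lemma holds_i_pred (A : {A | D A}) (P : predicate L') (a : (arity P).-tuple (sval A))
    (v : (arity P).-tuple (r.-tuple (i_target I A))) :
  (forall i, tnth v i \in i_iota I (tnth a i)) -> i_sat (i_pred I P) v = holds a.
Proof.
move=> va; rewrite (i_iota_morph II); apply/idP/existsP => [sv|[w]].
  by exists v; rewrite sv andbT; apply/forallP.
(* [i_iota_morph] supplies only some representatives [w]; invariance carries the truth value from
   [w] to the given [v]. *)
case/andP=> /forallP wa; congr is_true; apply: (i_pred_invariant II) => i.
by rewrite (E_iota (wa i)) ?(iota_in_X (va i)) ?(iota_in_X (wa i)) ?va.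
Qed.

(** For quantifiers, every tuple of [X_A] represents an element, and every element has a
    representative because the blocks of a partition are nonempty. *)
Lemma sat_translate (V : Type) (phi : formula L' V) (A : {A | D A})
    (v : V -> r.-tuple (i_target I A)) (a : V -> sval A) :
  represents v a -> sat (translate phi) (env_reps v) = sat phi a.
Proof.
elim: phi v a => [{}V|{}V x y|{}V P t|{}V psi IH|{}V psi1 IH1 psi2 IH2|{}V psi IH]
  v a va; [by []| | | | |].
- rewrite /= sat_plug; have -> : map_tuple v [tuple x; y] = [tuple v x; v y].
    exact: val_inj.
  rewrite -[i_sat _ _]/(i_E (v x) (v y)) (E_iota (va x)) ?(iota_in_X (va y)) //.
  apply/idP/eqP => [vy|-> //]; exact: iota_disjoint vy (va y).
- by rewrite /= sat_plug; apply: holds_i_pred => i; rewrite !tnth_map.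
- by rewrite /= (IH _ _ va).
- by rewrite /= (IH1 _ _ va) (IH2 _ _ va).
- rewrite translate_Ex sat_Ex; apply/idP/existsP => [/sat_Exs[f]|[x sx]].
    rewrite sat_rename env_split_last /= => /andP[].
    rewrite sat_in_X => /X_in_iota[x ux] st; exists x.
    by rewrite -(IH (oapp v (mktuple f))) // => -[].
  have [u ux] := iota_nonempty x.
  apply/sat_Exs; exists (tnth u).
  rewrite sat_rename env_split_last.
  have -> : mktuple (tnth u) = u by apply: eq_from_tnth => j; rewrite tnth_mktuple.
  have st : sat (translate psi) (env_reps (oapp v u)) = sat psi (oapp a x).
    by apply: IH => -[].
  by rewrite /= st sx andbT sat_in_X /= (iota_in_X ux).
Qed.

(** Here [Some None] is a tuple [u] and [None] a tuple [w]; renaming by [Some] makes [phi] speak of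
    [u]. Membership in [X_A] is required separately because [translate] is controlled only on
    representatives. *)
Definition same_class (V : Type) (phi : formula L' (option V)) :
    formula L (option (option V) * 'I_r + 'I_s) :=
  And (And (in_X (Some None)) (in_X None))
    (translate (And (Eq L' (Some None) None) (rename Some phi))).

(** The classes are counted by giving each [u] the weight [1 / #|class of u|]; the
    inner sum vanishes when [u] is irrelevant, and then its inverse is [0]. *)
Lemma sum_same_class (R : realType) (V : Type) (phi : formula L' (option V))
    (A : {A | D A}) (v : V -> r.-tuple (i_target I A)) (a : V -> sval A) :
  represents v a ->
  (\sum_(u : r.-tuple (i_target I A)) (\sum_(w : r.-tuple (i_target I A))
     (sat (same_class phi) (env_reps (oapp (oapp v u) w)))%:R)^-1 =
   #|solutions phi a|%:R :> R)%R.
Proof.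
move=> va; pose f (u : r.-tuple (i_target I A)) : R :=
  ((\sum_(w : r.-tuple (i_target I A))
      (sat (same_class phi) (env_reps (oapp (oapp v u) w)))%:R)^-1)%R.
rewrite -[LHS]/(\sum_u f u)%R.
have sE u w x : u \in i_iota I x ->
    sat (same_class phi) (env_reps (oapp (oapp v u) w)) =
    (w \in i_iota I x) && sat phi (oapp a x).
  move=> ux; set e := env_reps _.
  rewrite -[LHS]/((sat (in_X (Some None)) e && sat (in_X None) e) &&
    sat (translate (And (Eq L' (Some None) None) (rename Some phi))) e).
  rewrite !sat_in_X [oapp _ _ _]/= (iota_in_X ux) [oapp _ _ _]/= andTb.
  have [wX|wX] := boolP (w \in i_X I A); last first.
    by apply/esym; apply: contraNF wX => /andP[/iota_in_X].
  have [y wy] := X_in_iota wX.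
  have vva : represents (oapp (oapp v u) w) (oapp (oapp a x) y).
    by move=> [[z|]|] //=; apply: va.
  rewrite (sat_translate _ vva) /= sat_rename.
  congr (_ && _); apply/eqP/idP => [-> //|wx]; exact: iota_disjoint wx wy.
have f0 u : u \notin i_X I A -> f u = 0%R.
  move=> /negbTE uX; rewrite /f big1 ?invr0 // => w _.
  by rewrite /= sat_in_X /= uX.
have fE u x : u \in i_iota I x ->
    f u = ((sat phi (oapp a x))%:R / #|i_iota I x|%:R)%R.
  move=> ux.
  rewrite /f (eq_bigr _ (fun w _ => congr1 (fun b : bool => b%:R%R) (sE u w x ux))).
  case: (sat phi _); last first.
    by rewrite mul0r big1 ?invr0 // => w _; rewrite andbF.
  rewrite mul1r; congr (_^-1)%R; rewrite -natr_sum; congr (_%:R)%R.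
  by rewrite -sum1_card [RHS]big_mkcond; apply: eq_bigr => w _; rewrite andbT; case: ifP.
(* Tuples outside [X_A] contribute [0]. The others are regrouped by class, and a class of [c] tuples
   whose element satisfies [phi] contributes [c * (1 / c)]. *)
rewrite (bigID (mem (i_X I A))) /= [X in (_ + X)%R]big1 // addr0.
rewrite -(cover_partition (iota_partition A)).
rewrite (finset.big_trivIset _ (partition_trivIset (iota_partition A))) /=.
rewrite big_imset /=; last by move=> x y _ _; apply: (i_iota_inj II).
rewrite -sum1_card natr_sum [RHS]big_mkcond; apply: eq_bigr => x _.
rewrite (eq_bigr _ (fE ^~ x)) sumr_const inE -[(_ *+ _)%R]mulr_natr.
have [u ux] := iota_nonempty x.
rewrite divfK; first by case: (sat phi _).
by rewrite pnatr_eq0 -lt0n; apply/card_gt0P; exists u.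
Qed.

(** * Saturation under [E_A] *)

Definition split_copy (V : Type) (x : (V + V) * 'I_r + 'I_s) :
    (V * 'I_r + 'I_s) + V * 'I_r :=
  match x with
  | inl (inl y, j) => inl (inl (y, j))
  | inl (inr y, j) => inr (y, j)
  | inr k => inl (inr k)
  end.

Lemma env_split_copy (V : Type) (A : {A | D A}) (v : V -> r.-tuple (i_target I A))
    (f : V * 'I_r -> i_target I A) :
  env_sum (env_reps v) f \o @split_copy V =
  env_reps (env_sum v (fun x => mktuple (fun j => f (x, j)))).
Proof. by apply/funext => -[[[y|y] j]|k] //=; rewrite tnth_mktuple. Qed.

(** Saturation of [psi] under [E_A]: the cells produced by the counting argument
    are not invariant on small structures. *)
Definition saturate (V : finType) (psi : formula L (V * 'I_r + 'I_s)) :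
    formula L (V * 'I_r + 'I_s) :=
  Exs (rename (@split_copy V)
    (And (BigAnd (enum V) (fun x => And (in_X (inr x))
                                     (plug [tuple inl x; inr x] (i_epsilon I))))
         (rename (fun x => match x with
                           | inl (y, j) => inl (inr y, j)
                           | inr k => inr k
                           end) psi))).

Lemma sat_saturate (V : finType) (psi : formula L (V * 'I_r + 'I_s)) (A : {A | D A})
    (v : V -> r.-tuple (i_target I A)) (a : V -> sval A) :
  represents v a ->
  sat (saturate psi) (env_reps v) <->
  exists2 w : V -> r.-tuple (i_target I A), represents w a & sat psi (env_reps w).
Proof.
move=> va.
have envE (w : V -> r.-tuple (i_target I A)) : env_reps (env_sum v w) \o
    (fun x : V * 'I_r + 'I_s => match x with
                           | inl (y, j) => inl (inr y, j)
                           | inr k => inr k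
                           end) = env_reps w.
  by apply/funext => -[[y j]|k].
have satE (w : V -> r.-tuple (i_target I A)) x :
    sat (And (in_X (inr x)) (plug [tuple inl x; inr x] (i_epsilon I)))
      (env_reps (env_sum v w)) = (w x \in i_iota I (a x)).
  rewrite [LHS]/= sat_in_X sat_plug /=.
  have -> : map_tuple (env_sum v w) [tuple inl x; inr x] = [tuple v x; w x].
    exact: val_inj.
  rewrite -[i_sat _ _]/(i_E (v x) (w x)).
  have [wX|wX] := boolP (w x \in i_X I A); first by rewrite (E_iota (va x) wX).
  by apply/esym; apply: contraNF wX => /iota_in_X.
split=> [/sat_Exs[f]|[w wa sw]].
  rewrite sat_rename env_split_copy.
  set w := fun x => mktuple _ => /andP[+ +].
  rewrite -/sat sat_BigAnd sat_rename envE => /allP wa sw; exists w => // x.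
  by rewrite -satE; apply: wa; rewrite mem_enum.
apply/sat_Exs; exists (fun xj => tnth (w xj.1) xj.2).
rewrite sat_rename env_split_copy.
have -> : (fun x => mktuple (fun j => tnth (w (x, j).1) (x, j).2)) = w.
  by apply/funext => x; apply: eq_from_tnth => j; rewrite tnth_mktuple.
apply/andP; split; last by rewrite -/sat sat_rename envE.
by rewrite -/sat sat_BigAnd; apply/allP => x _; rewrite satE.
Qed.

(** The truth of a saturation depends only on the elements represented, and [E_A]-related tuples
    represent the same element. *)
Lemma saturate_invariant (n : nat) (psi : formula L (tvars n r s)) :
  i_invariant (saturate psi).
Proof.
move=> A v w vw.
have /fin_all_exists[a va] : forall i, exists x, tnth v i \in i_iota I x.
  by move=> i; apply: X_in_iota; case: (vw i).
have wa : represents (tnth w) a.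
  by move=> i; case: (vw i) => _ wX; rewrite (E_iota (va i) wX).
by apply/idP/idP => /sat_saturate h; apply/(@sat_saturate _ _ _ _ a) => //; apply: h.
Qed.

Lemma exists_represents (V : finType) (A : {A | D A}) (a : V -> sval A) :
  exists v : V -> r.-tuple (i_target I A), represents v a.
Proof. exact: (fin_all_exists (fun x => iota_nonempty (a x))). Qed.

End Translation.

(** * Change of gauge *)

Section ChangeOfGauge.
Variable R : realType.
Import Order.TTheory GRing.Theory Num.Theory numFieldNormedType.Exports.
Local Open Scope classical_set_scope.
Local Open Scope ring_scope.

Lemma powR_cvg (T : Type) (F : set_system T) {FF : Filter F} (f : T -> R) (a x : R) :
  0 < a -> f i @[i --> F] --> a -> f i `^ x @[i --> F] --> a `^ x.
Proof.
move=> a0 fa.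
suff ctn : {for a, continuous (fun y : R => y `^ x)} by apply: (cvg_comp _ _ fa ctn).
apply/differentiable_continuous/derivable1_diffP.
by apply: derivable_powR; rewrite in_itv /= a0.
Qed.

Lemma asym_at_zero (I : Type) (size count : I -> nat) (N K : nat) (Phi : I -> Prop) :
  (exists Q : nat, forall i, Phi i -> (Q < size i)%N -> count i = 0%N) ->
  exists p, admissible K p /\
    asym_at size N Phi (fun i => (count i)%:R) (asym_code p : option (int * R)).
Proof.
move=> [Q hQ]; exists (0%N, 0); split; first by right.
by rewrite /asym_code eqxx; exists Q => i Pi lti /=; rewrite hQ.
Qed.

(** Since [size ^ r = t ^ (N * r)], comparison with this bound limits the exponent to [N * r]. *)
Lemma asym_at_polynomial (I : Type) (size count : I -> nat) (N r : nat)
    (Phi : I -> Prop) (c : option (int * R)) :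
  (0 < N)%N -> (forall i, count i <= size i ^ r)%N ->
  asym_at size N Phi (fun i => (count i)%:R) c ->
  exists p, admissible (N * r) p /\
    asym_at size N Phi (fun i => (count i)%:R) (asym_code p : option (int * R)).
Proof.
move=> N0 le_count ac.
pose F := tail size Phi (fun i => (size i, count i)).
have [] := @asym_nat_bounded R (nat * nat)%type F (fun x => root_size R N x.1) _ _ _
  (fun x => x.2) (fun x => (x.1 ^ r)%N) c (N * r) 1.
- exact: root_size_tail_gt0.
- exact: root_size_cvg.
- by case: (c) ac => [[]|].
- have c1 : (fun=> 1 : R) @ F --> (1 : R) by apply: cvg_cst.
  apply: cvg_trans c1; apply: near_eq_cvg; exists 0%N => i _ si /=.
  rewrite -invr_expz -exprnP exprM root_size_exp divff ?pnatr_eq0 -?lt0n //.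
  by rewrite powRr1 // natrX divff // expf_neq0 // pnatr_eq0 -lt0n.
- by exists 0%N => i _ _; apply: le_count.
- by move=> cz; apply: asym_at_zero.
- move=> [f lef [nu nu0 knu]]; exists (f, nu); split; first by left.
  by rewrite /asym_code /= gt_eqF.
Qed.

(** If the ambient size [s] satisfies [s ^ (e / N) ~ B / lambda] and [K = e * q],
    then [s ^ (f / N) ~ (B / lambda) ^ (f * q / K)]. *)
Lemma asym_at_change_gauge (I : Type) (size B count : I -> nat) (N K r E : nat)
    (Phi : I -> Prop) (c : option (int * R)) (p : nat * R) :
  (0 < N)%N -> (0 < K)%N ->
  (forall i, B i <= size i ^ r)%N -> (forall i, count i <= B i)%N ->
  asym_at size N Phi (fun i => (count i)%:R) c ->
  admissible E p -> asym_at size N Phi (fun i => (B i)%:R) (asym_code p) ->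
  ((0 < p.1)%N -> 0 < p.2 ->
     (p.1 %| K)%N \/ exists b, forall i, Phi i -> (B i <= b)%N) ->
  exists p', admissible K p' /\
    asym_at B K Phi (fun i => (count i)%:R) (asym_code p' : option (int * R)).
Proof.
move=> N0 K0 leB lec ac adm aB dvd.
pose f i := (size i, B i, count i).
pose t (x : nat * nat * nat) : R := root_size R N x.1.1.
pose G := tail B Phi f.
have FG : Filter G by apply: tail_filter.
(* As [B <= size ^ r], a large [B] forces a large ambient size, so what holds eventually along
   [size] holds eventually along [B]. *)
have finer : G --> tail size Phi f.
  move=> S [Q hQ]; exists (Q ^ r)%N => i Pi lti; apply: hQ => //.
  have : (Q ^ r < size i ^ r)%N by apply: leq_trans lti (leB i).
  rewrite !ltnNge; apply: contra => le.
  by case: (r) => // r'; rewrite leq_exp2r.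
have zero : (\forall x \near G, x.2 = 0%N) -> exists p', admissible K p' /\
    asym_at B K Phi (fun i => (count i)%:R) (asym_code p' : option (int * R)).
  by move=> ?; apply: asym_at_zero.
(* If [B] is bounded, the cell has no index with large [B], and the zero estimate holds
   vacuously. *)
have bounded b : (\forall x \near G, (x.1.2 <= b)%N) -> exists p', admissible K p' /\
    asym_at B K Phi (fun i => (count i)%:R) (asym_code p' : option (int * R)).
  move=> [Q hQ]; apply: zero; exists (maxn Q b) => i Pi; rewrite gtn_max => /andP[lQ lb].
  by have := hQ i Pi lQ; rewrite /= leqNgt lb.
have t_gt0 : \forall x \near G, 0 < t x.
  by apply: finer; apply: root_size_tail_gt0.
have t_cvg : (t x)^-1 @[x --> G] --> (0 : R).
  have tc : (t x)^-1 @[x --> tail size Phi f] --> (0 : R) by apply: root_size_cvg.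
  by move=> S /tc; apply: finer.
have B_gt0 : \forall x \near G, (0 < x.1.2)%N by exists 0%N.
case: adm aB dvd => [[_]|->]; last first.
  rewrite /asym_code eqxx => aB _; apply: (bounded 0%N).
  apply: finer; move: aB => [Q hQ]; exists Q => i Pi lti.
  by have /eqP := hQ i Pi lti; rewrite pnatr_eq0 => /eqP /= ->.
case: p => e lambda /= lambda0; rewrite /asym_code /= gt_eqF // => -[_ aB] dvd.
have {}aB : x.1.2%:R * t x ^ (- e%:Z) @[x --> G] --> lambda.
  by move=> S /aB; apply: finer.
have [e0|e0] := posnP e.
  (* With [e = 0] the limit says that [B] itself tends to [lambda], so it is eventually below
     [lambda + 1]. *)
  move: aB; rewrite e0 => /cvgr_lt/(_ (lambda + 1)).
  rewrite ltrDl => /(_ ltr01) aB; apply: (bounded (Num.truncn (lambda + 1))).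
  apply: filterS aB => x /=; rewrite oppr0 mulr1 => ltB.
  by rewrite -ltnS -(ltr_nat R) (lt_trans ltB) // truncnS_gt.
have [eK|[b hb]] := dvd e0 lambda0; last first.
  by apply: (bounded b); exists 0%N => i Pi _; apply: hb.
have {}ac : asym G t (fun x => x.2%:R) c.
  case: (c) ac => [[d mu] [mu0 hmu]|c0]; last exact: finer c0.
  by split=> // S /hmu; apply: finer.
have [] := asym_nat_bounded t_gt0 t_cvg ac aB; first by exists 0%N => i _ _; apply: lec.
  exact: zero.
move=> [g leg [nu nu0 knu]].
pose q := (K %/ e)%N; have Kq : K = (q * e)%N by rewrite divnK.
have q0 : (0 < q)%N by move: K0; rewrite Kq muln_gt0 => /andP[].
pose x := g%:R / e%:R : R.
have xE : (g * q)%:R / K%:R = x.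
  by rewrite Kq mulnC !natrM -mulf_div divff ?mul1r // pnatr_eq0 -lt0n.
(* The exponent satisfies [(g * q) / K = g / e], and [g <= e] keeps it at most [K]. The coefficient
   comes from raising [B * t ^ (- e)], which tends to [lambda], to the power [- g / e]. *)
exists ((g * q)%N, nu * lambda `^ (- x)); split.
  by left; split=> /=; [rewrite Kq mulnC leq_mul2l leg orbT|rewrite mulr_gt0 ?powR_gt0].
rewrite /asym_code /= gt_eqF ?mulr_gt0 ?powR_gt0 //; split.
  by rewrite mulr_gt0 ?powR_gt0.
suff : y.2%:R * root_size R K y.1.2 ^ (- Posz (g * q)) @[y --> G] -->
    nu * lambda `^ (- x) by [].
(* In the product of the two limits the powers of [t] cancel, because [e * x = g]. *)
have lim := cvgM knu (powR_cvg (x := - x) lambda0 aB).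
apply: cvg_trans (lim _ _).
apply: near_eq_cvg; near=> y => /=.
have ty : 0 < t y by near: y.
have By : (0 < y.1.2)%N by near: y.
have -> : (y.1.2%:R * t y ^ (- Posz e)) `^ (- x) = t y ^ (Posz g) * y.1.2%:R `^ (- x).
  have t_ge0 := ltW ty.
  rewrite powRM ?exprz_ge0 // mulrC; congr (_ * _).
  have xe : (- Posz e)%:~R * - x = (Posz g)%:~R :> R.
    by rewrite intrN mulrNN -!pmulrn mulrC divfK // pnatr_eq0 -lt0n.
  by rewrite -[in LHS]powR_intmul // -powRrM xe powR_intmul.
rewrite mulrA -(invr_expz (t y)) divfK ?expfz_neq0 ?gt_eqF //.
by rewrite -invr_expz -exprnP root_size_exp xE powRN.
Unshelve. all: by end_near. Qed.

End ChangeOfGauge.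

(** * The interpreted class *)

Section LcmSeq.
Variables (T : eqType) (P : pred T) (g : T -> nat).

Lemma dvdn_biglcm_seq (F : seq T) (x : T) :
  x \in F -> P x -> (g x %| \big[lcmn/1%N]_(y <- F | P y) g y)%N.
Proof.
elim: F => // y F IH; rewrite in_cons big_cons => /orP[/eqP<- Px|xF Px].
  by rewrite Px dvdn_lcml.
by case: ifP => _; rewrite ?(dvdn_trans _ (dvdn_lcmr _ _)) ?IH.
Qed.

Lemma biglcm_seq_dvdn (F : seq T) (m : nat) :
  (forall y, y \in F -> P y -> g y %| m)%N ->
  (\big[lcmn/1%N]_(y <- F | P y) g y %| m)%N.
Proof.
move=> h; rewrite big_seq_cond.
elim/big_rec: _ => [|y k /andP[yF Py] IH]; first exact: dvd1n.
by rewrite dvdn_lcm h.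
Qed.

Lemma biglcm_seq_gt0 (F : seq T) :
  (forall y, P y -> 0 < g y)%N -> (0 < \big[lcmn/1%N]_(y <- F | P y) g y)%N.
Proof. by move=> h; elim/big_rec: _ => // y k Py IH; rewrite lcmn_gt0 h. Qed.

End LcmSeq.

Lemma dvdn_lcm_upto (n k : nat) : (0 < k <= n)%N -> (k %| lcm_upto n)%N.
Proof.
by move=> kn; apply: (@dvdn_biglcm_seq _ xpredT id); rewrite // mem_index_iota.
Qed.

Lemma lcm_upto_gt0 (n : nat) : (0 < lcm_upto n)%N.
Proof.
by rewrite /lcm_upto big_nat_cond; apply: biglcm_seq_gt0 => k /andP[/andP[]].
Qed.

(** * From covers to partitions, and the estimates for the interpreted class *)

Section Assembly.
Import Order.TTheory GRing.Theory Num.Theory numFieldNormedType.Exports.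
Local Open Scope ring_scope.

(** Sentences that merely cover the index type yield a genuine partition: each
    index is assigned to the first estimate claimed by a sentence it satisfies. *)
Lemma cell_estimate_of_cover (R : realType) (N K : nat) (J : Type)
    (size count : J -> nat) (L : language) (V : Type) (M : J -> structure L)
    (b : forall j, V -> M j) (T : finType) (sigma : T -> formula L V) :
  (forall j, exists k, sat (sigma k) (b j)) ->
  (forall k, exists p, admissible K p /\
     asym_at size N (fun j => sat (sigma k) (b j)) (fun j => (count j)%:R)
       (asym_code p : option (int * R))) ->
  exists (D : seq (nat * R)) (theta : nat * R -> formula L V),
    cell_estimate N K size count D (fun p j => sat (theta p) (b j)).
Proof.
move=> cover /fin_all_exists[a est].
pose D := undup (map a (enum T)); pose rk p := index p D.
have aD k : a k \in D by rewrite mem_undup map_f // mem_enum.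
pose theta p := And (BigOr [seq k <- enum T | a k == p] sigma)
                  (Not (BigOr [seq k <- enum T | rk (a k) < rk p]%N sigma)).
have thetaP p j : sat (theta p) (b j) <->
    (exists2 k, a k = p & sat (sigma k) (b j)) /\
    forall k, sat (sigma k) (b j) -> (rk p <= rk (a k))%N.
  rewrite [sat _ _]/(sat (BigOr _ _) _ && ~~ sat (BigOr _ _) _) !sat_BigOr.
  split=> [/andP[/hasP[k]]|[[k kp sk] min]].
    rewrite mem_filter => /andP[/eqP kp _] sk /hasPn min; split; first by exists k.
    move=> l sl; rewrite leqNgt; apply/negP => lt.
    by have := min l; rewrite mem_filter lt mem_enum sl => /(_ isT).
  apply/andP; split; first apply/hasP.
    by exists k; rewrite // mem_filter kp eqxx mem_enum.
  apply/hasPn => l; rewrite mem_filter => /andP[lt _].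
  by apply: contraTN lt => /min; rewrite -leqNgt.
exists D, theta; split.
- by move=> p; rewrite mem_undup => /mapP[k _ ->]; case: (est k).
- move=> j; have [k0 s0] := cover j.
  case: (@arg_minnP _ k0 (fun k => sat (sigma k) (b j)) (fun k => rk (a k)) s0).
  move=> k sk min.
  exists (a k); split; first by split=> //; apply/thetaP; split=> //; exists k.
  move=> q [qD /thetaP[[l lq sl] qmin]].
  have e : rk (a k) = rk q by apply/eqP; rewrite eqn_leq qmin // -lq min.
  by rewrite -(nth_index (a k) (aD k)) -/(rk _) e nth_index.
- move=> p; rewrite mem_undup => /mapP[k0 _ pk0] g eps eps0.
  have /fin_all_exists[Q hQ] : forall k, exists Q : nat, a k = p ->
      forall j, sat (sigma k) (b j) -> (Q < size j)%N ->
      `|(count j)%:R - p.2 * g j| <= eps * g j.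
    move=> k; have [kp|] := pselect (a k = p); last by exists 0%N.
    have [adm /(littleo_asym_at _ _ _ _ adm)/(_ _ eps0)[Q hQ]] := est k.
    by exists Q => _ j; rewrite /g -kp; apply: hQ.
  (* Several sentences may claim the estimate [p]; the maximum of the thresholds serves them all. *)
  exists (\max_k Q k)%N => j /thetaP[[k kp sk] _] lt.
  by apply: (hQ k) => //; apply: leq_ltn_trans lt; apply: leq_bigmax.
Qed.

Variables (R : realType) (L L' : language).
Variables (C : structure_class L) (D : structure_class L') (N r : nat).
Variable I : interpretation_data C D r.
Hypothesis asymC : asymptotic_class R N C.
Hypothesis II : is_interpretation I.

Let N_gt0 : (0 < N)%N := proj1 asymC.

Definition reps_index (V : Type) (A : {A | D A}) (v : V -> r.-tuple (i_target I A)) :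
  env_index C (V * 'I_r + 'I_(i_npar I)) := mk_env (env_reps v).

(** The double sum of [sum_same_class], extended to all ambient assignments, even those representing
    nothing, because estimability concerns all of them. The uses of [split_last] detach the
    coordinates of [u] and [w] as summation variables. *)
Definition class_count (V : Type) (phi : formula L' (option V))
    (i : env_index C (V * 'I_r + 'I_(i_npar I))) : R :=
  \sum_(u : r.-tuple (sval (tag i))) (\sum_(w : r.-tuple (sval (tag i)))
    (sat (rename (@split_last _ _ _ _ _ I _) (same_class I phi))
       (env_sum (env_sum (tagged i) (tnth u) \o @split_last _ _ _ _ _ I V)
          (tnth w)))%:R)^-1.

Lemma estimable_class_count (V : finType) (phi : formula L' (option V)) :
  estimable N (class_count phi).
Proof.
have := estimable_indicator R C N (rename (@split_last _ _ _ _ _ I _) (same_class I phi)).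
move=> /(estimable_sum_tuple N_gt0 asymC)/estimableV.
move=> /(estimable_rename (@split_last _ _ _ _ _ I V)).
by move=> /(estimable_sum_tuple N_gt0 asymC).
Qed.

Lemma class_countE (V : Type) (phi : formula L' (option V)) (A : {A | D A})
    (v : V -> r.-tuple (i_target I A)) (a : V -> sval A) :
  represents v a -> class_count phi (reps_index v) = #|solutions phi a|%:R.
Proof.
move=> va; rewrite -(sum_same_class II R phi va).
have tK (u : r.-tuple (i_target I A)) : mktuple (tnth u) = u.
  by apply: eq_from_tnth => j; rewrite tnth_mktuple.
apply: eq_bigr => u _; congr (_^-1); apply: eq_bigr => w _.
by rewrite sat_rename /= env_split_last tK env_split_last tK.
Qed.

(** A choice of representatives is injective, the classes being disjoint. *)
Lemma card_interpreted (A : {A | D A}) : (#|sval A| <= #|i_target I A| ^ r)%N.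
Proof.
have /fin_all_exists[f hf] := iota_nonempty II (A := A).
rewrite -card_tuple; apply: (leq_card f) => x y e.
by apply: (iota_disjoint II (hf x)); rewrite e.
Qed.

(** [|A|] counts the solutions of a valid formula without parameters, so the counting cells involve
    only the parameters of the interpretation. *)
Lemma exists_size_partition :
  exists (F : seq (nat * R)) (chi : nat * R -> formula L 'I_(i_npar I)),
    size_partition N F chi.
Proof.
pose phi := Top L' (option 'I_0).
have [T [theta [part est]]] := estimable_class_count phi.
pose par (x : 'I_0 * 'I_r + 'I_(i_npar I)) : 'I_(i_npar I) :=
  match x with inl ij => False_rect _ (notF (ltn_ord ij.1)) | inr k => k end.
have reps0 (A : {A | D A}) (v : 'I_0 -> r.-tuple (i_target I A)) :
    tnth (i_par I A) \o par = env_reps v.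
  by apply/funext => -[[[]]|].
pose v0 (A : {A | D A}) (i : 'I_0) : r.-tuple (i_target I A) :=
  False_rect _ (notF (ltn_ord i)).
apply: (@cell_estimate_of_cover _ _ _ _ _ _ _ _ (fun A => i_target I A) _ T
          (fun k => rename par (theta k))) => [A|k].
  have /eqP/card1P[k hk] := part (reps_index (v0 A)).
  by exists k; have := hk k; rewrite !inE eqxx sat_rename (reps0 A (v0 A)).
have [c ac] := est k.
apply: (@asym_at_polynomial _ _ _ _ _ _ _ c N_gt0 card_interpreted).
apply: asym_at_transfer ac => A; rewrite sat_rename (reps0 A (v0 A)) => sA.
exists (reps_index (v0 A)); split=> //.
pose a0 (i : 'I_0) : sval A := False_rect _ (notF (ltn_ord i)).
rewrite (@class_countE _ phi A (v0 A) a0); last by case.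
by congr (_%:R); apply: eq_card => x; rewrite !inE.
Qed.

Hypothesis QTR : quotient_trace_reflecting I.

(** Each cell joins a reflected saturated counting cell, which estimates [|phi(A; a)|], with a
    reflected size cell, which estimates [|A|]; the change of gauge combines the two. Leaving [K]
    open serves both [L_Q] and the full least common multiple. *)
Lemma asymptotic_class_of_partition (F : seq (nat * R))
    (chi : nat * R -> formula L 'I_(i_npar I)) (K : nat) :
  size_partition N F chi -> (0 < K)%N ->
  (forall e, target_exponents F chi e -> (e %| K)%N) ->
  asymptotic_class R K D.
Proof.
move=> [admF partF estF] K0 dvdK; split=> // n phi.
have [T [theta [part est]]] := estimable_class_count phi.
have /fin_all_exists[cellT cellTE] := fun k => QTR (saturate_invariant II (theta k)).
(* With [m = 0] there are no representatives to vary, so invariance is immediate. *)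
have chi_inv p : i_invariant (rename inr (chi p) : formula L (tvars 0 r (i_npar I))).
  by move=> A v w _; rewrite (tuple0 v) (tuple0 w).
have /fin_all_exists[cellF cellFE] := fun p : seq_sub F => QTR (chi_inv (ssval p)).
pose J := {A : {A | D A} & n.-tuple (sval A)}.
pose sigma (kp : T * seq_sub F) :=
  And (cellT kp.1) (rename (widen_ord (leq0n n)) (cellF kp.2)).
(* It is enough that some choice of representatives lies in the counting cell, since the class count
   is the same for every choice. The resulting cells cover but may overlap. *)
have cellTP k (j : J) : sat (cellT k) (tnth (tagged j)) <->
    exists2 w : 'I_n -> r.-tuple (i_target I (tag j)),
      represents w (tnth (tagged j)) & sat (theta k) (env_reps w).
  have [v va] := exists_represents II (tnth (tagged j)).
  have vE : tnth (mktuple v) = v by apply/funext => x; rewrite tnth_mktuple.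
  rewrite (cellTE k _ _ (mktuple v)); last by apply/forallP => x; rewrite vE.
  by rewrite -(sat_saturate II (theta k) va) -[in X in _ <-> X]vE.
have cellFP p (j : J) : sat (rename (widen_ord (leq0n n)) (cellF p)) (tnth (tagged j)) =
    sat (chi (ssval p)) (tnth (i_par I (tag j))).
  rewrite sat_rename.
  have -> : tnth (tagged j) \o widen_ord (leq0n n) = tnth [tuple] by apply/funext => -[].
  rewrite (cellFE p _ _ [tuple]); last by apply/forallP => -[].
  by rewrite /i_sat /tsat sat_rename.
apply: (@cell_estimate_of_cover _ _ _ J _ _ _ _ (fun j => sval (tag j)) _ _ sigma)
  => [j|[k p]].
  have [v va] := exists_represents II (tnth (tagged j)).
  have /eqP/card1P[k hk] := part (reps_index v).
  have [p [[pF sp] _]] := partF (tag j).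
  exists (k, SeqSub pF); apply/andP; split; last by rewrite -/sat cellFP.
  apply/cellTP; exists v => //.
  by have := hk k; rewrite !inE eqxx.
have [c ac] := est k.
apply: (@asym_at_change_gauge _ _ (fun j : J => #|i_target I (tag j)|) _ _ N K r
          (N * r) _ c
          (ssval p)) => //.
- by move=> j; apply: card_interpreted.
- by move=> j; apply: max_card.
- apply: asym_at_transfer ac => j /andP[/cellTP[w wa sw] _].
  by exists (reps_index w); split=> //; apply: class_countE.
- exact: admF (ssvalP p).
- have /(littleo_asym_at _ _ _ _ (admF _ (ssvalP p))) := estF _ (ssvalP p).
  apply: asym_at_transfer => j /andP[_]; rewrite -/sat cellFP => sj.
  by exists (tag j).
- move=> e0 lambda0.
  (* Either [|A|] is bounded on the size cell, or the exponent of that cell is a target exponent and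
     hence divides [K]. *)
  have [bdd|unb] := pselect (exists b : nat, forall A,
      sat (chi (ssval p)) (tnth (i_par I A)) -> (#|sval A| <= b)%N).
    right; have [b hb] := bdd; exists b => j /andP[_]; rewrite -/sat cellFP.
    exact: hb.
  left; apply: dvdK; split=> //; exists (ssval p).2.
  rewrite -surjective_pairing; split=> //; first exact: ssvalP.
  move=> b; apply: contrapT => nex; apply: unb; exists b => A sA.
  by rewrite leqNgt; apply/negP => lt; apply: nex; exists A.
Qed.

End Assembly.

Theorem theoremB (R : realType) (L L' : language)
    (C : structure_class L) (D : structure_class L') (N r : nat)
    (I : interpretation_data C D r) :
  asymptotic_class R N C ->
  (0 < r)%N ->
  is_interpretation I ->
  quotient_trace_reflecting I ->
  [/\ exists (F : seq (nat * R)) (chi : nat * R -> formula L 'I_(i_npar I)),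
        size_partition N F chi,
      forall (F : seq (nat * R)) (chi : nat * R -> formula L 'I_(i_npar I)),
        size_partition N F chi ->
        asymptotic_class R (L_Q F chi) D /\ (L_Q F chi %| lcm_upto (N * r)%N)%N
    & asymptotic_class R (lcm_upto (N * r)%N) D].
Proof.
move=> asymC _ II QTR.
(* A target exponent is positive and, by admissibility in [F], at most [N * r], hence one of the
   numbers whose least common multiple is taken. *)
have dvd_upto (F : seq (nat * R)) (chi : nat * R -> formula L 'I_(i_npar I)) e :
    size_partition N F chi -> target_exponents F chi e -> (e %| lcm_upto (N * r))%N.
  move=> [adm _ _] [e0 [lambda [lambda0 eF _]]]; apply: dvdn_lcm_upto; rewrite e0 /=.
  by case: (adm _ eF) => [[]|[e00 _]] //; rewrite e00.
have [F [chi part]] := exists_size_partition asymC II.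
split; first by exists F, chi.
- move=> {F chi part} F chi part; split.
    apply: (asymptotic_class_of_partition asymC II QTR part).
      by apply: biglcm_seq_gt0 => p; rewrite inE => -[].
    move=> e ex; have [_ [lambda [_ eF _]]] := ex.
    by apply: (@dvdn_biglcm_seq _ _ fst _ _ eF); rewrite inE.
  by apply: biglcm_seq_dvdn => p _; rewrite inE; apply: dvd_upto.
- apply: (asymptotic_class_of_partition asymC II QTR part (lcm_upto_gt0 _)) => e.
  exact: dvd_upto part.
Qed.
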